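(* If $\nu>-1$ and $n\in\mathbb{N}$, then all zeros (in the complex variable $z$) of the hypergeometric polynomials $${}_1F_3\left(-n;\nu+1,\frac{\nu}{2}+1,\frac{\nu}{2}+\frac{3}{2};z\right)\quad\text{and}\quad {}_1F_3\left(-n;\nu+1,\frac{\nu}{2}+\frac{1}{2},\frac{\nu}{2}+1;z\right)$$ are real.
   Context: Here $\mathbb{N}=\{1,2,\dots\}$ and ${}_1F_3(-n;b_1,b_2,b_3;z)=\sum_{k=0}^{n}\frac{(-n)_k}{(b_1)_k(b_2)_k(b_3)_k}\frac{z^k}{k!}$, where $(a)_0=1$ and $(a)_k=a(a+1)\cdots(a+k-1)$. *)

(* Defs.v *)
From HB Require Import structures.
From mathcomp Require Import all_boot all_order all_algebra.
From mathcomp Require Import reals complex.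

Set Implicit Arguments.
Unset Strict Implicit.
Unset Printing Implicit Defensive.

Import Order.TTheory GRing.Theory Num.Theory.
Local Open Scope ring_scope.

(* Rising factorial: the library's falling factorial n ^_ k is on nat only. *)
Definition pochhammer (F : fieldType) (a : F) (k : nat) : F :=
  \prod_(i < k) (a + i%:R).

(* 1F3(-n; b1, b2, b3; z). It is a genuine (division-by-zero free) expression
   when no b_j is one of 0, -1, ..., -(n - 1). *)
Definition hyp1F3 (F : fieldType) (n : nat) (b1 b2 b3 z : F) : F :=
  \sum_(k < n.+1)
    pochhammer (- n%:R) k
      / (pochhammer b1 k * pochhammer b2 k * pochhammer b3 k)
    * (z ^+ k / k`!%:R).

(* Main.v *)
Require Import Defs.
From HB Require Import structures.
From mathcomp Require Import all_boot all_order all_algebra.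
From mathcomp Require Import reals complex.
From mathcomp Require Import ring lra.

Import Order.TTheory GRing.Theory Num.Theory.
Local Open Scope ring_scope.
Local Open Scope complex_scope.

(** Since (-n)_k / k! = (-1)^k 'C(n, k), the polynomial 1F3(-n; b1, b2, b3; z)
    is obtained from (1 - z)^n, whose zeros are real, by dividing the
    coefficient of z^k by (b1)_k, then by (b2)_k, then by (b3)_k. For nu > -1
    all the lower parameters are positive, so it suffices to show that for
    b > 0 the operator L_b : z^k |-> z^k / (b)_k preserves the class of
    polynomials with only real zeros ([real_rooted_divpoch]).

    This is proved by induction on the number of zeros, for all b > 0 at once.
    If Q = L_{b+1} q, then ([divpoch_XsubC])
      b L_b ((z - r) q) = z Q - r (z Q' + b Q),
    so a non-real zero z of the left-hand side satisfies, when r != 0,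
      1 / r = Q'(z) / Q(z) + b / z.
    Here 1 / r is real. On the right, Q'/Q is the sum of the 1 / (z - s) over
    the zeros s of Q, counted with multiplicity, which are real by induction;
    hence no term has imaginary part of the same sign as that of z, and b / z
    has one of the opposite sign: the two sides cannot be equal
    ([real_rooted_first_order]). *)

Section RealRooted.

Variable C : numClosedFieldType.
Implicit Types (p q : {poly C}) (b r z : C).

(** The zero polynomial is excluded, since it vanishes at the imaginary
    unit. *)
Definition real_rooted p := forall z, root p z -> z \is Num.real.

Lemma real_rooted_neq0 p : real_rooted p -> p != 0.
Proof.
move=> p_real; apply/eqP => p0.
by have := p_real 'i%R; rewrite p0 root0 => /(_ isT); rewrite (negPf (nonRealCi _)).
Qed.

Lemma real_rootedM p q : real_rooted p -> real_rooted q -> real_rooted (p * q).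
Proof. by move=> p_real q_real z; rewrite rootM => /orP[/p_real|/q_real]. Qed.

Lemma real_rootedC c : c != 0 -> real_rooted c%:P.
Proof. by move=> c_neq0 z; rewrite rootC (negPf c_neq0). Qed.

Lemma real_rooted_XsubC r : r \is Num.real -> real_rooted ('X - r%:P).
Proof. by move=> r_real z; rewrite root_XsubC => /eqP->. Qed.

(** The step provides that the cofactor is again real-rooted, so that one can
    divide by its value at a non-real point. *)
Lemma real_rooted_ind (P : {poly C} -> Prop) :
    (forall c, c != 0 -> P c%:P) ->
    (forall r q, r \is Num.real -> real_rooted q -> P q ->
      P (('X - r%:P) * q)) ->
  forall p, real_rooted p -> P p.
Proof.
move=> Pconst Pfactor p p_real.
have lc_neq0 : lead_coef p != 0 by rewrite lead_coef_eq0 real_rooted_neq0.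
have [rs p_def] := closed_field_poly_normal p.
have rs_real r : r \in rs -> r \is Num.real.
  by move=> r_in; apply: p_real; rewrite p_def rootZ // root_prod_XsubC.
rewrite p_def -mul_polyC mulrC; move: (lead_coef p) lc_neq0 => c c_neq0.
suff [] : real_rooted (\prod_(r <- rs) ('X - r%:P) * c%:P)
          /\ P (\prod_(r <- rs) ('X - r%:P) * c%:P) by [].
elim: rs rs_real {p_def} => [|r rs IHrs] rs_real.
  by rewrite big_nil mul1r; split; [apply: real_rootedC | apply: Pconst].
have r_real : r \is Num.real by apply: rs_real; rewrite mem_head.
have [|q_real Pq] := IHrs.
  by move=> s s_in; apply: rs_real; rewrite inE s_in orbT.
rewrite big_cons -mulrA; split; last exact: Pfactor.
by apply: real_rootedM => //; apply: real_rooted_XsubC.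
Qed.

Lemma Im_mul_ImV_lt0 z : z \isn't Num.real -> 'Im z * 'Im z^-1 < 0.
Proof.
move=> z_nreal.
have z_neq0 : z != 0 by apply: contraNneq z_nreal => ->; rewrite real0.
have Im_neq0 : 'Im z != 0.
  by apply: contraNneq z_nreal => /Creal_ImP.
have norm_gt0 : 0 < `|z| ^- 2 by rewrite invr_gt0 exprn_gt0 // normr_gt0.
rewrite invC_norm ImMl ?gtr0_real // Im_conj mulrN mulrN oppr_lt0 mulrCA.
by rewrite mulr_gt0 // lt_def mulf_neq0 // -expr2 -realEsqr Creal_Im.
Qed.

(** The logarithmic derivative is the sum of the 1 / (z - s) over the zeros s,
    and z - s has the same imaginary part as z because s is real. *)
Lemma Im_mul_Im_logderiv_le0 p z : real_rooted p -> z \isn't Num.real ->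
  'Im z * 'Im (p^`().[z] / p.[z]) <= 0.
Proof.
move=> p_real z_nreal; elim/real_rooted_ind: p / p_real => [c _|r q r_real].
  by rewrite derivC horner0 mul0r raddf0 mulr0.
move=> q_real IHq.
have qz_neq0 : q.[z] != 0.
  by apply: contraNneq z_nreal => /eqP; apply: q_real.
have zr_nreal : z - r \isn't Num.real by rewrite rpredBr.
have zr_neq0 : z - r != 0 by apply: contraNneq zr_nreal => ->; rewrite real0.
have -> : (('X - r%:P) * q)^`().[z] / (('X - r%:P) * q).[z]
          = (z - r)^-1 + q^`().[z] / q.[z].
  rewrite derivM derivXsubC mul1r hornerD !hornerM hornerXsubC.
  by field; rewrite qz_neq0 zr_neq0.
rewrite raddfD mulrDr -[leRHS]addr0 lerD //.
have -> : 'Im z = 'Im (z - r) by move/Creal_ImP: r_real => Im_r; rewrite raddfB /= Im_r subr0.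
exact/ltW/Im_mul_ImV_lt0.
Qed.

Lemma pochhammer0 b : pochhammer b 0 = 1.
Proof. exact: big_ord0. Qed.

Lemma pochhammerSr b k : pochhammer b k.+1 = pochhammer b k * (b + k%:R).
Proof. exact: big_ord_recr. Qed.

Lemma pochhammerSl b k : pochhammer b k.+1 = b * pochhammer (b + 1) k.
Proof.
rewrite /pochhammer big_ord_recl addr0; congr (_ * _).
by apply: eq_bigr => i _; rewrite -addrA -natr1 [1 + _]addrC.
Qed.

Lemma pochhammer_gt0 b k : 0 < b -> 0 < pochhammer b k.
Proof. by move=> b_gt0; apply: prodr_gt0 => i _; rewrite ltr_wpDr. Qed.

Definition divpoch b p := \poly_(k < size p) (p`_k / pochhammer b k).

Lemma coef_divpoch b p k : (divpoch b p)`_k = p`_k / pochhammer b k.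
Proof.
by rewrite coef_poly; case: ltnP => // le_p_k; rewrite nth_default ?mul0r.
Qed.

(** Passing from b to b + 1 along with removing a linear factor is what makes
    a first-order differential expression appear: (b)_(k+1) = b (b + 1)_k
    handles the multiplication by the variable, and
    1 / (b)_k = (b + k) / (b (b + 1)_k) the remaining term. *)
Lemma divpoch_XsubC b r q : 0 < b ->
  b *: divpoch b (('X - r%:P) * q)
  = 'X * divpoch (b + 1) q
    - r *: ('X * (divpoch (b + 1) q)^`() + b *: divpoch (b + 1) q).
Proof.
move=> b_gt0; have b_neq0 := lt0r_neq0 b_gt0; apply/polyP => -[|k].
  rewrite mulrBl mul_polyC.
  rewrite !(coefZ, coefB, coefD, coefXM, coef_divpoch) /= !pochhammer0.
  by field.
have b1_gt0 : 0 < b + 1 by rewrite addr_gt0.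
have poch_neq0 := lt0r_neq0 (pochhammer_gt0 _ k b1_gt0).
have bk_neq0 : b + 1 + k%:R != 0 by rewrite lt0r_neq0 // ltr_wpDr.
rewrite mulrBl mul_polyC.
rewrite !(coefZ, coefB, coefD, coefXM, coef_deriv, coef_divpoch) /=.
rewrite pochhammerSl pochhammerSr -[_ *+ k.+1]mulr_natr -natr1.
by field; rewrite b_neq0 poch_neq0 bk_neq0.
Qed.

(** At a non-real zero with r != 0, dividing by r z q(z) gives
    1 / r = q'(z) / q(z) + b / z, which the signs of the imaginary parts
    forbid; for r = 0 only the zeros of z q(z) are left. *)
Lemma real_rooted_first_order b r q :
    0 < b -> r \is Num.real -> real_rooted q ->
  real_rooted ('X * q - r *: ('X * q^`() + b *: q)).
Proof.
move=> b_gt0 r_real q_real z; apply: contraTT => z_nreal.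
have z_neq0 : z != 0 by apply: contraNneq z_nreal => ->; rewrite real0.
have qz_neq0 : q.[z] != 0.
  by apply: contraNneq z_nreal => /eqP; apply: q_real.
rewrite rootE !hornerE; apply/negP => /eqP eq0.
have r_neq0 : r != 0.
  apply/eqP => r0; move/eqP: eq0.
  by rewrite r0 mul0r subr0 mulf_eq0 (negPf z_neq0) (negPf qz_neq0).
have rV : r^-1 = q^`().[z] / q.[z] + b * z^-1.
  apply/eqP; rewrite -subr_eq0; apply/eqP.
  have -> : r^-1 - (q^`().[z] / q.[z] + b * z^-1)
            = (z * q.[z] - r * (z * q^`().[z] + b * q.[z])) / (r * z * q.[z]).
    by field; rewrite r_neq0 z_neq0 qz_neq0.
  by rewrite eq0 mul0r.
have /eqP := congr1 (fun w => 'Im z * 'Im w) rV.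
have /Creal_ImP -> : r^-1 \is Num.real by rewrite realV.
rewrite mulr0 eq_sym lt_eqF //.
rewrite raddfD /= ImMl ?gtr0_real // mulrDr ltr_wnDl //.
  exact: Im_mul_Im_logderiv_le0.
by rewrite mulrCA pmulr_rlt0 // Im_mul_ImV_lt0.
Qed.

Lemma real_rooted_divpoch b p :
  0 < b -> real_rooted p -> real_rooted (divpoch b p).
Proof.
move=> b_gt0 p_real.
elim/real_rooted_ind: p / p_real b b_gt0 => [c c_neq0|r q r_real _ IHq] b b_gt0.
  suff -> : divpoch b c%:P = c%:P by apply: real_rootedC.
  apply/polyP => k; rewrite coef_divpoch coefC.
  by case: k => [|k] /=; rewrite ?pochhammer0 ?divr1 ?mul0r.
move=> z; rewrite -(rootZ _ _ (lt0r_neq0 b_gt0)) divpoch_XsubC //.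
by apply: real_rooted_first_order => //; apply: IHq; rewrite addr_gt0.
Qed.

Lemma pochhammerN_fact n k :
  pochhammer (- n%:R : C) k / k`!%:R = (-1) ^+ k * 'C(n, k)%:R.
Proof.
have fact_neq0 : k`!%:R != 0 :> C by rewrite pnatr_eq0 -lt0n fact_gt0.
apply: (canLR (mulfK fact_neq0)); rewrite -mulrA -natrM bin_ffact.
elim: k {fact_neq0} => [|k IHk]; first by rewrite pochhammer0 mul1r.
rewrite pochhammerSr IHk ffactnSr natrM exprS.
have [le_kn|lt_nk] := leqP k n; first by rewrite natrB //; ring.
by rewrite ffact_small // !(mul0r, mulr0).
Qed.

Lemma hyp1F3_horner n b1 b2 b3 z :
  hyp1F3 n b1 b2 b3 z
  = (divpoch b1 (divpoch b2 (divpoch b3 ((1 - 'X) ^+ n)))).[z].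
Proof.
have pow_def : (1 - 'X : {poly C}) ^+ n
                 = \poly_(k < n.+1) ((-1) ^+ k * 'C(n, k)%:R).
  rewrite poly_def exprBn; apply: eq_bigr => k _.
  rewrite expr1n mulr1 -scalerA scaler_nat -mul_polyC.
  by rewrite polyC_exp polyCN polyC1 mulrnAr.
rewrite (@horner_coef_wide _ n.+1); last first.
  by do 3![apply: leq_trans (size_poly _ _) _]; rewrite pow_def size_poly.
apply: eq_bigr => k _; rewrite !coef_divpoch pow_def coef_poly ltn_ord -pochhammerN_fact.
by rewrite !invfM; ring.
Qed.

Lemma hyp1F3_real n b1 b2 b3 z :
    0 < b1 -> 0 < b2 -> 0 < b3 ->
  hyp1F3 n b1 b2 b3 z = 0 -> z \is Num.real.
Proof.
move=> b1_gt0 b2_gt0 b3_gt0 /eqP; rewrite hyp1F3_horner.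
do 3![apply: real_rooted_divpoch => //]; elim: n => [|n IHn] {z}.
  by rewrite expr0; apply: real_rootedC; apply: oner_neq0.
rewrite exprS; apply: real_rootedM => //.
by move=> z; rewrite rootE !hornerE subr_eq0 => /eqP <-; apply: real1.
Qed.

End RealRooted.

Theorem theorem2 (R : realType) (nu : R) (n : nat)
    (hnu : -1 < nu) (hn : (0 < n)%N) :
  (forall z : R[i],
     hyp1F3 n (nu + 1)%:C (nu / 2 + 1)%:C (nu / 2 + 3 / 2)%:C z = 0 ->
     z \is Num.real) /\
  (forall z : R[i],
     hyp1F3 n (nu + 1)%:C (nu / 2 + 1 / 2)%:C (nu / 2 + 1)%:C z = 0 ->
     z \is Num.real).
Proof.
by split=> z; apply: hyp1F3_real; rewrite ltcR; lra.
Qed.
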